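(* Let $G$ be a metrizable locally compact group. Then no infinite subset of $G$ can be an approximable $\mathcal{AP}(G)$-interpolation set.
   Context: Let $e$ be the identity of $G$. $\mathcal{AP}(G)$ is the algebra of almost periodic functions: bounded continuous $f:G\to\mathbb C$ whose set of left translates $f_s(t)=f(st)$, $s\in G$, is relatively compact in the supremum norm. $T\subseteq G$ is an approximable $\mathcal{AP}(G)$-interpolation set if every bounded $f:T\to\mathbb C$ extends to a function in $\mathcal{AP}(G)$ and, for every neighbourhood $U$ of $e$, there are open neighbourhoods $V_1,V_2$ of $e$ with $\overline{V_1}\subseteq V_2\subseteq U$ such that for each $T_1\subseteq T$ there is $h\in\mathcal{AP}(G)$ with $h(V_1T_1)\subseteq\{1\}$ and $h(G\setminus V_2T_1)\subseteq\{0\}$. *)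

(* Defs.v *)
From HB Require Import structures.
From mathcomp Require Import all_boot all_order all_algebra.
From mathcomp Require Import all_classical all_reals all_analysis.
From mathcomp Require Import complex.

Set Implicit Arguments.
Unset Strict Implicit.
Unset Printing Implicit Defensive.

Import Order.TTheory GRing.Theory Num.Theory.
Import numFieldNormedType.Exports.

Local Open Scope classical_set_scope.
Local Open Scope ring_scope.

HB.mixin Record isTopologicalGroup G & Topological G & Group G := {
  mulg_continuous : continuous (fun xy : G * G => (xy.1 * xy.2)%g);
  invg_continuous : continuous (fun x : G => (x^-1)%g)
}.

#[short(type="topologicalGroupType")]
HB.structure Definition TopologicalGroup :=
  {G of Topological G & Group G & isTopologicalGroup G}.

Definition metrizable (R : realType) (X : topologicalType) : Prop :=
  exists d : X -> X -> R,
    [/\ forall x y, 0 <= d x y,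
        forall x y, d x y = 0 <-> x = y,
        forall x y, d x y = d y x,
        forall x y z, d x z <= d x y + d y z &
        forall (x : X) (A : set X),
          nbhs x A <-> exists2 e : R, 0 < e & [set y | d x y < e] `<=` A].

(* The topology and norm of a numFieldType are only inferred when the carrier
   is presented as a structure, whence this packaging of R[i].  The norm takes
   its values in R[i] itself: it is the usual modulus, as a complex number. *)
Definition Cplx (R : realType) : numClosedFieldType := R[i].

Section AlmostPeriodic.
Context (R : realType) (G : topologicalGroupType).
Local Notation C := (Cplx R).

Definition left_translate (f : G -> C) (s : G) : G -> C := fun t => f (s * t)%g.

(* {uniform G -> C} carries the topology of uniform convergence on G, which
   is the supremum-norm topology on bounded functions.  The bounded functions
   are closed in it, so relative compactness does not depend on whether the
   closure is taken among the bounded functions or among all functions. *)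
Definition almost_periodic (f : G -> C) : Prop :=
  [/\ continuous f, bounded_fun f &
      precompact (range (left_translate f) : set {uniform G -> C})].

Definition mulset (A B : set G) : set G :=
  [set (a * b)%g | a in A & b in B].

(* A function on T is represented by (the restriction to T of) a total
   function, of which only the values on T are used. *)
Definition AP_interpolation_set (T : set G) : Prop :=
  forall f : G -> C, [bounded f t | t in T] ->
    exists2 g : G -> C, almost_periodic g & {in T, g =1 f}.

Definition approximable_AP_interpolation_set (T : set G) : Prop :=
  AP_interpolation_set T /\
  forall U : set G, nbhs (1%g : G) U ->
    exists V1 V2 : set G,
      [/\ open_nbhs (1%g : G) V1, open_nbhs (1%g : G) V2,
          closure V1 `<=` V2, V2 `<=` U &
          forall T1 : set G, T1 `<=` T ->
            exists h : G -> C,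
              [/\ almost_periodic h,
                  h @` mulset V1 T1 `<=` [set 1] &
                  h @` (~` mulset V2 T1) `<=` [set 0]]].

End AlmostPeriodic.

(* Main.v *)
(** An approximable interpolation set with a point [t] yields a function [h]
    in AP(G), nonzero at [t] and supported in a compact set.  Finitely many
    translates of [h] approximate all the others, so finitely many translates
    of the support cover [G], and [G] is compact.  An infinite subset of the
    compact metrizable group [G] contains an injective convergent sequence, and
    the function alternating between 1 and 0 along this sequence has no
    continuous extension. *)

Require Import Defs.
From mathcomp Require Import all_boot all_order all_algebra.
From mathcomp Require Import all_classical all_reals all_analysis.

Import Order.TTheory GRing.Theory Num.Theory.
Import numFieldNormedType.Exports.

Local Open Scope classical_set_scope.
Local Open Scope ring_scope.

Lemma translation_continuous (G : topologicalGroupType) (a b : G) :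
  continuous (fun x : G => (a * x * b)%g).
Proof.
move=> x.
have ax : (fun y : G => (a * y)%g) @ x --> (a * x)%g.
  apply: (cvg_comp2 (cvg_cst a) cvg_id).
  exact: (@mulg_continuous G (a, x)).
apply: (cvg_comp2 ax (cvg_cst b)).
exact: (@mulg_continuous G ((a * x)%g, b)).
Qed.

(** Covering is replaced by filters: along a proper filter [F] the translates of [h] cluster
    uniformly at some [g], and the points whose translates are close to [g] all lie in one compact
    set, where [F] must then cluster. *)
Lemma compact_support_AP_compact (R : realType) (G : topologicalGroupType)
    (h : G -> Cplx R) (t : G) (S : set G) :
  almost_periodic h -> h t != 0 -> compact S ->
  (forall x, h x != 0 -> S x) -> compact [set: G].
Proof.
move=> [_ _ [K rK [cK _]]] ht0 cS hS F FF _.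
(* With this radius, two functions uniformly [e]-close to [g] differ by less than [|h t|] at every
   point. *)
pose e := `|h t| / 2.
have e0 : 0 < e by rewrite divr_gt0// normr_gt0.
(* The inverse makes [phi s] vanish outside [s S] and take the value [h t] at [s t]. *)
pose phi (s : G) : {uniform G -> Cplx R} := left_translate h (s^-1)%g.
have FT : F setT by exact: filterT.
have KF : F (phi @^-1` K) by apply: filterS FT => s _; apply: rK; exists s^-1%g.
have [g [_ clg]] := cK (phi @ F) _ KF.
pose W : set {uniform G -> Cplx R} := [set u | forall y, ball (g y) e (u y)].
have Wg : nbhs g W.
  apply/uniform_nbhs; exists [set z | ball z.1 e z.2]; split.
    by rewrite -entourage_ballE; exists e.
  by move=> u /= uW y; exact: uW.
pose P := phi @^-1` W.
have meetP A : F A -> exists2 s, A s & P s.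
  move=> FA; have phiA : F (phi @^-1` (phi @` A)).
    by apply: filterS FA => s As; exists s.
  by have [_ [[s As <-] Ws]] := clg _ _ phiA Wg; exists s.
have [s0 _ Ps0] := meetP _ FT.
pose S' : set G := (fun x => (s0 * x * t^-1)%g) @` S.
have cS' : compact S'.
  apply: continuous_compact cS; apply: continuous_subspaceT.
  exact: translation_continuous.
have PS' : P `<=` S'.
  move=> s Ps; exists (s0^-1 * s * t)%g; last by rewrite !mulgA mulgV mul1g mulgK.
  (* Compare [phi s0] and [phi s] at [s t]: the values would be 0 and [h t], too far apart. *)
  apply: hS; apply/eqP => hs0.
  have := ball_triangle (ball_sym (Ps0 (s * t)%g)) (Ps (s * t)%g).
  rewrite /phi /left_translate /= mulgA hs0 mulKg -ball_normE /=.
  by rewrite sub0r normrN /e -splitr ltxx.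
(* The trace of [F] on [P] is proper and contains [S']; being finer than [F], its cluster points are
   cluster points of [F]. *)
have FP : ProperFilter (within P F).
  apply: Build_ProperFilter_ex => A FA.
  have [s As Ps] := meetP _ FA.
  by exists s; exact: As.
have FS' : within P F S' by apply: filterS FT => s _; exact: PS'.
have [x [_ clx]] := cS' _ FP FS'.
exists x; split=> //; apply: cvg_cluster clx => A FA.
exact: filterS FA.
Qed.

(** Any cluster point of the filter of sets containing all but finitely many points of [T] works,
    since removing that point from [T] leaves a member of the filter. *)
Lemma infinite_compact_limit_point (X : topologicalType) (T : set X) :
  compact [set: X] -> infinite_set T -> limit_point T !=set0.
Proof.
move=> cX iT; pose F : set_system X := [set A | finite_set (T `\` A)].
have FF : ProperFilter F.
  apply: Build_ProperFilter.
    by rewrite /F/= setD0.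
  split; rewrite /F/=.
  - by rewrite setDT.
  - by move=> A B fA fB; rewrite /mkset setDIr finite_setU.
  - by move=> A B AB; apply: sub_finite_set => y [Ty nB]; split=> // /AB.
have [x [_ clx]] := cX F FF filterT.
exists x => A Ax.
have Fx : F (T `\ x).
  apply: (@sub_finite_set _ _ [set x]) => // y [Ty nT].
  by apply: contrapT => yx; apply: nT.
by have [y [[Ty /eqP yx] Ay]] := clx _ _ Fx Ax; exists y.
Qed.

Lemma metrizable_limit_point_seq (R : realType) (X : topologicalType)
    (T : set X) (x : X) : metrizable R X -> limit_point T x ->
  exists u : nat -> X, [/\ injective u, forall n, T (u n) & u @ \oo --> x].
Proof.
move=> [d [d0 d_eq0 _ _ dnbhs]] limx.
have dgt0 y : y <> x -> 0 < d x y.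
  by move=> yx; rewrite lt0r d0 andbT; apply/eqP => /d_eq0/esym.
(* The condition on [e] sits under the existential so that choice gives a total function; [x] is a
   dummy value for [e <= 0]. *)
have ex_near e : exists y, 0 < e -> [/\ y <> x, T y & d x y < e].
  have [e0|] := ltP 0 e; last by exists x.
  have [|y [/eqP yx Ty xy]] := limx [set y | d x y < e].
    by apply/dnbhs; exists e.
  by exists y.
have [s sP] := choice ex_near.
(* Halving the distance to [x] at each step gives both injectivity (strict decrease) and convergence
   (geometric bound). *)
pose u := fix u n := if n is n'.+1 then s (d x (u n') / 2) else s 1.
have ux n : u n <> x.
  elim: n => [|n IHn] /=; first by have [] := sP 1 ltr01.
  by have [|] := sP (d x (u n) / 2); rewrite ?divr_gt0 ?dgt0.
have uT n : T (u n).
  case: n => [|n] /=; first by have [] := sP 1 ltr01.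
  by have [|] := sP (d x (u n) / 2); rewrite ?divr_gt0 ?dgt0 //; exact: ux.
have uS n : d x (u n.+1) < d x (u n) / 2.
  by have [|] := sP (d x (u n) / 2); rewrite ?divr_gt0 ?dgt0 //; exact: ux.
have du_decr : {homo (fun n => d x (u n)) : m n / (m < n)%N >-> n < m}.
  apply: homo_ltn => [y z w|n]; first by move=> yz /lt_trans; apply.
  apply: lt_trans (uS n) _.
  by rewrite ltr_pdivrMr// ltr_pMr ?ltr1n// dgt0 //; exact: ux.
exists u; split=> // [m n umn|].
  by case: (ltngtP m n) => // /du_decr; rewrite umn ltxx.
have du_geo n : d x (u n) < 2^-1 ^+ n.
  elim: n => [|n IHn]; first by have [] := sP 1 ltr01.
  apply: lt_trans (uS n) _.
  by rewrite exprSr ltr_pM2r// invr_gt0.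
move=> A /dnbhs[e e0 eA].
have geo0 : (fun n => 2^-1 ^+ n : R) @ \oo --> 0.
  by apply: cvg_expr; rewrite gtr0_norm ?invr_gt0// invf_lt1 ?ltr1n.
have : \forall n \near \oo, (2^-1 ^+ n : R) < e by apply: cvgr_lt geo0 _ e0.
by apply: filterS => n ne; apply: eA; exact: lt_trans (du_geo n) ne.
Qed.

Lemma convergent_seq_not_AP_interpolation (R : realType)
    (G : topologicalGroupType) (T : set G) (u : nat -> G) (x : G) :
  injective u -> (forall n, T (u n)) -> u @ \oo --> x ->
  ~ AP_interpolation_set R T.
Proof.
move=> injx uT ux APT.
(* Indicator of the even-indexed terms; injectivity of [u] makes it 0 at the odd-indexed ones. *)
pose f (y : G) : Cplx R := (`[< exists k, y = u k.*2 >])%:R.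
have fb : [bounded f t | t in T].
  exists 1; split; first exact: real1.
  move=> M M1 y _; apply: le_trans (ltW M1).
  by rewrite /= /f; case: (`[< _ >]); rewrite ?normr1 ?normr0 ?ler01.
have [g [gcont _ _] gf] := APT f fb.
have gu n : g (u n) = (~~ odd n)%:R.
  rewrite gf ?inE//; congr (nat_of_bool _)%:R; apply/asboolP/idP.
    by move=> [k /injx ->]; rewrite odd_double.
  by move=> /even_halfK {1}<-; exists n./2.
have gux : (g \o u) @ \oo --> g x by apply: cvg_comp ux (gcont x).
have half0 : 0 < (2^-1 : Cplx R) by rewrite invr_gt0.
have /cvgrPdist_lt/(_ _ half0)[N _ NP] := gux.
have := ler_distD (g x) (g (u N.*2)) (g (u N.*2.+1)).
rewrite [`|g (u N.*2) - g x|]distrC.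
(* Both indices are at least [N], so the values 1 and 0 would each be within 1/2 of [g x], giving
   [1 < 1]. *)
move=> /le_lt_trans /(_ (ltrD (NP _ _) (NP _ _))).
rewrite !gu /= odd_double subr0 normr1 -[2^-1]div1r -splitr ltxx => lt11.
suff: false by []; apply: lt11 => /=.
  by rewrite -addnn leq_addr.
by rewrite -addnn -addnS leq_addr.
Qed.

Theorem corollary4p24 (R : realType) (G : topologicalGroupType) :
  metrizable R G -> locally_compact [set: G] ->
  forall T : set G, infinite_set T ->
    ~ approximable_AP_interpolation_set R T.
Proof.
move=> mG lG T iT [APT appT].
have [t Tt] := infinite_setN0 iT.
have [U + [cU _]] := lG 1%g I.
rewrite withinET => U1.
(* Taking [T1] to be a single point confines the support of [h] to [V2 t], inside the compact set
   [U t]. *)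
have [V1 [V2 [[_ V11] _ _ V2U /(_ [set t])]]] := appT U U1.
case=> [_ ->//|h [APh h1 h0]].
have ht : h t = 1.
  by apply: h1; exists t => //; exists 1%g => //; exists t; rewrite ?mul1g.
have cG : compact [set: G].
  pose S := (fun x => (1 * x * t)%g) @` U.
  apply: (@compact_support_AP_compact R G h t S) => //.
  - by rewrite ht oner_neq0.
  - by apply: continuous_compact cU; apply: continuous_subspaceT;
      exact: translation_continuous.
  - move=> x hx; apply: contrapT => nUx; move/eqP: hx; apply; apply: h0.
    exists x => // -[v V2v [_ -> vt]]; apply: nUx; exists v; first exact: V2U.
    by rewrite mul1g.
have [x limx] := infinite_compact_limit_point _ _ cG iT.
have [u [injx uT ux]] := metrizable_limit_point_seq _ _ _ _ mG limx.
exact: (convergent_seq_not_AP_interpolation _ _ _ _ _ injx uT ux APT).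
Qed.
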